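(* The timescale $\tau_n$ of the charging process governed by the ODE system $$\mathbf{C}(\zeta)\,\dot\zeta=\alpha\,(-\mathcal{T}\zeta+Y),\qquad\zeta(0)=0,$$ is given by $$\tau_n=\frac1{\lambda_c},$$ where $\lambda_c$ is the smallest positive eigenvalue of the matrix $\alpha\,\mathbf{C}(\zeta^\infty)^{-1}\mathcal{T}$ and $\zeta^\infty$ is the equilibrium solution of the system.
   Context: Let $n>2$ be an integer, $z_-<0<z_+$, $V_\pm\in\mathbb{R}$, $\mathcal{L},H>0$ with $\mathcal{L}+H=1$, $h=H/(n-1)$, and $\alpha=z_-^2z_+-z_+^2z_->0$. Define $$C(u)=\mathrm{sgn}(u)\frac{z_+z_-\left(e^{-z_+u}-e^{-z_-u}\right)}{\sqrt2\sqrt{-z_-e^{-z_+u}+z_+e^{-z_-u}+z_--z_+}},$$ extended by continuity to $u=0$, and for $\zeta\in\mathbb{R}^{2n}$ $$\mathbf{C}(\zeta)=\mathrm{diag}\{C(\zeta_1),2C(\zeta_2),\dots,2C(\zeta_{2n-1}),C(\zeta_{2n})\}.$$ $\mathcal{T}$ is the symmetric tridiagonal $2n\times2n$ matrix with $\mathcal{T}_{1,1}=\mathcal{T}_{2n,2n}=\frac1h$; $\mathcal{T}_{n,n}=\mathcal{T}_{n+1,n+1}=\frac1h+\frac1{2\mathcal{L}}$; $\mathcal{T}_{i,i}=\frac2h$ for all other $i$; $\mathcal{T}_{n,n+1}=\mathcal{T}_{n+1,n}=-\frac1{2\mathcal{L}}$; $\mathcal{T}_{i,i+1}=\mathcal{T}_{i+1,i}=-\frac1h$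 for all other $1\le i\le2n-1$. The vector $Y\in\mathbb{R}^{2n}$ has $Y_n=-\frac{V_+-V_-}{2\mathcal{L}}$, $Y_{n+1}=-\frac{V_--V_+}{2\mathcal{L}}$ and all other entries $0$. The equilibrium solution $\zeta^\infty$ is the limit as $t\to\infty$ of the solution of the ODE system with zero initial conditions; it satisfies $\mathcal{T}\zeta^\infty=Y$. **Charging timescale.** The matrix $\mathbf{C}(\zeta^\infty)^{-1}\mathcal{T}$ has $2n$ distinct eigenvalues $\lambda_1=0$ and $\lambda_k>0$, $k=2,\dots,2n$. Let $\mathbf{Q}=(v_1,\dots,v_{2n})$ be an invertible matrix whose columns are corresponding eigenvectors, let $\mathbf{S}$ be the $(2n-1)\times2n$ matrix with $\mathbf{S}_{i,i+1}=1$ and all other entries $0$, and let $\mathbf{P}=\mathbf{S}\mathbf{Q}^{-1}$ (which projects out the direction of the zero eigenvalue). The linearization about $\zeta^\infty$ of the projected ODE system $\mathbf{P}\dot\zeta=\alpha[-\mathbf{P}\mathbf{C}(\zeta)^{-1}\mathcal{T}\zeta+\mathbf{P}\mathbf{C}(\zeta)^{-1}Y]$, for a perturbation $q(t)\in\mathbb{R}^{2n}$, is $$\mathbf{P}\dot q=-\alpha\,\mathbf{P}\,\mathbf{C}(\zeta^\infty)^{-1}\mathcal{T}q .$$ The charging timescale $\tau_n$ is the relaxation timescale of the projected perturbation $\mu=\mathbf{P}q$, i.e. the reciprocal of its slowest exponential decay rate: $1/\tau_n$ is the largest $r$ such that every solution satisfies $|\mu(t)|\le Ke^{-rt}$ for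 all $t\ge0$, for some constant $K$ depending on the solution. *)

(* Defs.v *)
From HB Require Import structures.
From mathcomp Require Import all_boot all_order all_algebra.
From mathcomp Require Import all_classical all_reals all_analysis.

Set Implicit Arguments.
Unset Strict Implicit.
Unset Printing Implicit Defensive.

Import Order.TTheory GRing.Theory Num.Theory.
Import numFieldNormedType.Exports.

Local Open Scope classical_set_scope.
Local Open Scope ring_scope.

Definition alpha (R : realType) (zm zp : R) : R :=
  zm ^+ 2 * zp - zp ^+ 2 * zm.

Definition capacitance_formula (R : realType) (zm zp u : R) : R :=
  Num.sg u *
  (zp * zm * (expR (- (zp * u)) - expR (- (zm * u))) /
   (Num.sqrt 2 *
    Num.sqrt (- zm * expR (- (zp * u)) + zp * expR (- (zm * u)) + zm - zp))).

(* At 0 the formula is 0/0; the value there is its limit over u -> 0, u != 0. *)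
Definition capacitance (R : realType) (zm zp u : R) : R :=
  if u == 0 then lim (capacitance_formula zm zp x @[x --> (0 : R)^'])
  else capacitance_formula zm zp u.

(* Indices 1, ..., 2n of the mathematical text are 0, ..., 2n - 1 below. *)

Definition capacitance_mx (R : realType) (n : nat) (zm zp : R)
    (zeta : 'cV[R]_(2 * n)) : 'M[R]_(2 * n) :=
  diag_mx (\row_(i < 2 * n)
    (if (i == 0%N :> nat) || (i == (2 * n).-1 :> nat)
     then capacitance zm zp (zeta i 0)
     else 2 * capacitance zm zp (zeta i 0))).

Definition tridiag_mx (R : realType) (n : nat) (L H : R) : 'M[R]_(2 * n) :=
  let h := H / (n%:R - 1) in
  \matrix_(i < 2 * n, j < 2 * n)
    if i == j then
      if (i == 0%N :> nat) || (i == (2 * n).-1 :> nat) then 1 / h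
      else if (i == n.-1 :> nat) || (i == n :> nat) then 1 / h + 1 / (2 * L)
      else 2 / h
    else if (j == i.+1 :> nat) || (i == j.+1 :> nat) then
      if minn i j == n.-1 then - (1 / (2 * L)) else - (1 / h)
    else 0.

Definition source_vec (R : realType) (n : nat) (L Vp Vm : R) :
    'cV[R]_(2 * n) :=
  \col_(i < 2 * n)
    if i == n.-1 :> nat then - ((Vp - Vm) / (2 * L))
    else if i == n :> nat then - ((Vm - Vp) / (2 * L))
    else 0.

(* Classical solutions on the half-line: continuous on [0, +oo) and satisfying
   the equation on (0, +oo); what happens at negative times is irrelevant. *)
Definition charging_solution (R : realType) (n : nat)
    (zm zp Vp Vm L H : R) (zeta : R -> 'cV[R]_(2 * n)) : Prop :=
  {within `[0, +oo[, continuous zeta} /\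
  forall t : R, 0 < t ->
    derivable zeta t 1 /\
    capacitance_mx zm zp (zeta t) *m 'D_1 zeta t =
      alpha zm zp *: (- (tridiag_mx n L H *m zeta t) + source_vec n L Vp Vm).

Definition relaxation_mx (R : realType) (n : nat) (zm zp L H : R)
    (zinf : 'cV[R]_(2 * n)) : 'M[R]_(2 * n) :=
  invmx (capacitance_mx zm zp zinf) *m tridiag_mx n L H.

(* The columns of Q are eigenvectors of A for the pairwise distinct eigenvalues
   lam, the one of index 0 being zero and the others positive. *)
Definition ordered_eigenbasis (R : realType) (m : nat) (A : 'M[R]_m)
    (lam : 'I_m -> R) (Q : 'M[R]_m) : Prop :=
  [/\ Q \in unitmx,
      forall k, A *m col k Q = lam k *: col k Q,
      injective lam &
      forall k : 'I_m, if k == 0%N :> nat then lam k = 0 else 0 < lam k].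

Definition shift_mx (R : realType) (m : nat) : 'M[R]_(m.-1, m) :=
  \matrix_(i < m.-1, j < m) (j == i.+1 :> nat)%:R.

Definition projection_mx (R : realType) (m : nat) (Q : 'M[R]_m) :
    'M[R]_(m.-1, m) :=
  shift_mx R m *m invmx Q.

(* Solutions of P q' = - a P A q. *)
Definition projected_linear_solution (R : realType) (m : nat) (a : R)
    (A : 'M[R]_m) (P : 'M[R]_(m.-1, m)) (q : R -> 'cV[R]_m) : Prop :=
  {within `[0, +oo[, continuous q} /\
  forall t : R, 0 < t ->
    derivable q t 1 /\ P *m 'D_1 q t = - (a *: (P *m A *m q t)).

(* The norm is the max norm on column vectors; since K is arbitrary, any other
   norm gives the same set of rates. *)
Definition decay_rate (R : realType) (m : nat) (a : R)
    (A : 'M[R]_m) (P : 'M[R]_(m.-1, m)) (r : R) : Prop :=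
  forall q : R -> 'cV[R]_m, projected_linear_solution a A P q ->
    exists K : R, forall t : R, 0 <= t -> `|P *m q t| <= K * expR (- (r * t)).

Definition charging_timescale (R : realType) (n : nat) (zm zp L H : R)
    (zinf : 'cV[R]_(2 * n)) (Q : 'M[R]_(2 * n)) (tau : R) : Prop :=
  let rate := decay_rate (alpha zm zp) (relaxation_mx zm zp L H zinf)
                (projection_mx Q) in
  rate (1 / tau) /\ forall r : R, rate r -> r <= 1 / tau.

(* [eigenvalue] is about row eigenvectors; for a square matrix the eigenvalues
   are the same as those for column eigenvectors. *)
Definition smallest_positive_eigenvalue (R : realType) (m : nat)
    (A : 'M[R]_m) (l : R) : Prop :=
  [/\ eigenvalue A l, 0 < l &
      forall l' : R, eigenvalue A l' -> 0 < l' -> l <= l'].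

(* Main.v *)
(* The system matrix is the Laplacian T of a weighted path, so A = C^-1 T, with
   C diagonal and positive, is similar to a real symmetric tridiagonal matrix
   with nonzero off-diagonal entries. Such a matrix has simple real spectrum:
   the first coordinate of an eigenvector determines the others. By the maximum
   principle the eigenvalues of A are nonnegative, and constant vectors span the
   kernel. In an eigenbasis the projected equation decouples into
   mu_i' = - alpha lambda_i mu_i with lambda_i > 0; the slowest mode decays
   exactly at the rate alpha min lambda_i. Positivity of C at 0 comes from
   C^2 = g^2 / (2 f) with f' = g, so that C(0)^2 = g'(0) = alpha by L'Hopital's
   rule. *)
Require Import Defs.
From HB Require Import structures.
From mathcomp Require Import all_boot all_order all_algebra.
From mathcomp Require Import all_classical all_reals all_analysis.
From mathcomp Require Import perm complex spectral zify ring lra.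

Set Implicit Arguments.
Unset Strict Implicit.
Unset Printing Implicit Defensive.

Import Order.TTheory GRing.Theory Num.Theory.
Import numFieldNormedType.Exports.

Local Open Scope classical_set_scope.
Local Open Scope ring_scope.

(** * Spectrum of path Laplacians *)

(** Column [k] of the equation involves the coordinates of [v] up to [k + 1] only, the last one with
    a nonzero subdiagonal coefficient, so each coordinate is determined by the earlier ones. *)
Lemma hessenberg_row_eq0 (F : fieldType) (m : nat) (S : 'M[F]_m) (l : F)
    (v : 'rV[F]_m) (i0 : 'I_m) :
  (forall i j : 'I_m, (j.+1 < i)%N -> S i j = 0) ->
  (forall i j : 'I_m, i = j.+1 :> nat -> S i j != 0) ->
  v *m S = l *: v -> i0 = 0%N :> nat -> v 0 i0 = 0 -> v = 0.
Proof.
move=> S0 Sn0 vS i00 v0.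
suff vk k : forall j : 'I_m, (j <= k)%N -> v 0 j = 0.
  by apply/rowP => j; rewrite mxE (vk j).
elim: k => [|k IHk] j.
  rewrite leqn0 => /eqP j0; rewrite -v0; congr (v 0 _).
  by apply: val_inj; rewrite /= j0.
rewrite leq_eqVlt ltnS => /predU1P[jk|]; last exact: IHk.
have km : (k < m)%N by apply: leq_trans (ltn_ord j); rewrite jk.
have := congr1 (fun w : 'rV_m => w 0 (Ordinal km)) vS.
rewrite !mxE (IHk (Ordinal km)) // mulr0 (bigD1 j) //= big1 => [|i ij].
  rewrite addr0 => /eqP.
  by rewrite mulf_eq0 (negPf (Sn0 _ _ _)) ?orbF // => /eqP.
have [ik|ki] := leqP i k; first by rewrite IHk // mul0r.
rewrite S0 ?mulr0 //= ltn_neqAle ki andbT -jk.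
by apply: contra ij => /eqP e; apply/eqP/val_inj.
Qed.

Lemma row_mul_diag_mx (F : comNzRingType) (m n : nat) (d : 'rV[F]_m)
    (P : 'M[F]_(m, n)) k : row k (diag_mx d *m P) = d 0 k *: row k P.
Proof. by rewrite row_mul row_diag_mx -scalemxAl -rowE. Qed.

Lemma row_unit_neq0 (F : fieldType) (m : nat) (P : 'M[F]_m) k :
  P \in unitmx -> row k P != 0.
Proof.
move=> Pu; apply/eqP => rk0.
have /rowP/(_ k) : delta_mx 0 k *m P *m invmx P = 0 :> 'rV_m.
  by rewrite -rowE rk0 mul0mx.
by rewrite mulmxK // !mxE !eqxx => /eqP; rewrite oner_eq0.
Qed.

(** Two rows of [P] with the same eigenvalue have a nontrivial combination with zero first
    coordinate. It still satisfies the eigenvector equation, so it vanishes, against the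
    independence of the rows. *)
Lemma hessenberg_diag_inj (F : fieldType) (m : nat) (S P : 'M[F]_m)
    (d : 'rV[F]_m) :
  (forall i j : 'I_m, (j.+1 < i)%N -> S i j = 0) ->
  (forall i j : 'I_m, i = j.+1 :> nat -> S i j != 0) ->
  P \in unitmx -> P *m S = diag_mx d *m P -> injective (d 0).
Proof.
move=> S0 Sn0 Pu PS i j dij; apply/eqP/negP => /negP ij.
pose i0 : 'I_m := Ordinal (leq_ltn_trans (leq0n i) (ltn_ord i)).
have rowS k : row k P *m S = d 0 k *: row k P.
  by rewrite -row_mul PS row_mul_diag_mx.
have row_neq0 k : P k i0 != 0.
  apply: contraNneq (row_unit_neq0 k Pu) => Pk0; apply/eqP.
  by apply: (hessenberg_row_eq0 S0 Sn0 (rowS k) (i0 := i0)); rewrite ?mxE.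
pose w : 'rV[F]_m := P j i0 *: delta_mx 0 i - P i i0 *: delta_mx 0 j.
have wP : w *m P = P j i0 *: row i P - P i i0 *: row j P.
  by rewrite mulmxBl -!scalemxAl -!rowE.
have : w *m P = 0.
  apply: (@hessenberg_row_eq0 _ _ S (d 0 i) _ i0) => //; rewrite wP.
    rewrite mulmxBl -!scalemxAl !rowS -dij scalerBr !scalerA.
    by rewrite !(mulrC (d 0 i)).
  by rewrite !mxE mulrC subrr.
move=> /(congr1 (mulmx^~ (invmx P))); rewrite mulmxK // mul0mx.
move=> /rowP/(_ i); rewrite !mxE !eqxx (negPf ij) mulr0 subr0 mulr1.
by move/eqP; apply/negP.
Qed.

(* Diagonalizing over the complex numbers gives m distinct real eigenvalues; the
   corresponding real eigenvectors are orthogonal, so V is invertible. *)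
Lemma jacobi_eigenbasis (R : rcfType) (m : nat) (S : 'M[R]_m) :
  S^T = S ->
  (forall i j : 'I_m, (j.+1 < i)%N -> S i j = 0) ->
  (forall i j : 'I_m, i = j.+1 :> nat -> S i j != 0) ->
  exists (V : 'M[R]_m) (d : 'rV[R]_m),
    [/\ V \in unitmx, injective (d 0) & V *m S = diag_mx d *m V].
Proof.
move=> Ssym S0 Sn0.
pose f := real_complex R; pose Sc := map_mx f S.
have Sc_sym : Sc \is symmetricmx.
  by apply/is_hermitianmxP; rewrite expr0 scale1r map_mx_id // map_trmx Ssym.
have Sc_real : Sc \is a mxOver Num.real.
  by apply/mxOverP => i j; rewrite mxE; apply/complex_realP; exists (S i j).
have Sc_herm := realsym_hermsym Sc_sym Sc_real.
have /orthomx_spectralP Sc_eq := hermitian_normalmx Sc_herm.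
have sp_real := hermitian_spectral_diag_real Sc_herm.
set P := spectralmx Sc in Sc_eq; set sp := spectral_diag Sc in Sc_eq sp_real.
have Pu : P \in unitmx by apply: spectral_unit.
have PSc : P *m Sc = diag_mx sp *m P by rewrite Sc_eq !mulmxA mulmxV ?mul1mx.
have sp_inj : injective (sp 0).
  apply: (hessenberg_diag_inj _ _ Pu PSc) => i j ij; rewrite mxE.
    by rewrite S0 // rmorph0.
  by rewrite fmorph_eq0 Sn0.
(* A Hermitian matrix has real spectrum, so taking real parts loses nothing. *)
pose d : 'rV[R]_m := \row_j complex.Re (sp 0 j).
have fd j : f (d 0 j) = sp 0 j.
  by rewrite mxE; apply: RRe_real; apply/mxOverP.
have d_inj : injective (d 0) by move=> i j dij; apply: sp_inj; rewrite -!fd dij.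
have ev j : exists v : 'rV[R]_m, (v *m S == d 0 j *: v) && (v != 0).
  have /eigenvalueP[v vS vn0] : eigenvalue S (d 0 j).
    rewrite -(eigenvalue_map f) [X in eigenvalue _ X](fd j).
    apply/eigenvalueP; exists (row j P); last exact: row_unit_neq0.
    by rewrite -row_mul PSc row_mul_diag_mx.
  by exists v; rewrite vS eqxx.
pose v j := xchoose (ev j).
have /all_and2[vS vn0] j : v j *m S = d 0 j *: v j /\ v j != 0.
  by have /andP[/eqP] := xchooseP (ev j).
pose V := \matrix_(j, k) v j 0 k.
have rowV j : row j V = v j by apply/rowP => k; rewrite !mxE.
have VS : V *m S = diag_mx d *m V.
  by apply/row_matrixP => j; rewrite row_mul row_mul_diag_mx rowV vS.
exists V, d; split=> //.
(* Evaluating [V *m S *m V^T] in two ways, by the symmetry of [S], shows that rows for distinct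
   eigenvalues are orthogonal. *)
have VVd i j : (d 0 i - d 0 j) * (V *m V^T) i j = 0.
  have : V *m S *m V^T = V *m (V *m S)^T by rewrite trmx_mul Ssym mulmxA.
  rewrite VS trmx_mul tr_diag_mx mulmxA -mulmxA => /matrixP/(_ i j).
  rewrite mul_diag_mx mul_mx_diag mxE [RHS]mxE mulrBl (mulrC (d 0 j)) => ->.
  by rewrite subrr.
have vv j : (V *m V^T) j j != 0.
  rewrite !mxE psumr_neq0 => [|k _]; last by rewrite !mxE -expr2 sqr_ge0.
  have /rV0Pn[k vjk] := vn0 j.
  apply/hasP; exists k; first by rewrite mem_index_enum.
  by rewrite !mxE -expr2 exprn_even_gt0.
have VVdiag : V *m V^T = diag_mx (\row_j (V *m V^T) j j).
  apply/matrixP => i j; rewrite [RHS]mxE; have [->|ij] := eqVneq i j.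
    by rewrite [RHS]mxE.
  have /eqP := VVd i j; rewrite /= mulf_eq0 subr_eq0 => /predU1P[/d_inj|/eqP//].
  by move/eqP; rewrite (negPf ij).
have : V *m V^T \in unitmx.
  rewrite VVdiag unitmxE det_diag unitfE; apply/prodf_neq0 => j _.
  by rewrite mxE.
by rewrite unitmx_mul => /andP[].
Qed.

(* Maximum principle: look at the equation in a row where |u| is maximal. *)
Lemma laplacian_eigenvalue_ge0 (R : realFieldType) (m : nat) (T : 'M[R]_m)
    (d : 'rV[R]_m) (l : R) (u : 'cV[R]_m) :
  (forall i j, i != j -> T i j <= 0) -> (forall i, \sum_j T i j = 0) ->
  (forall i, 0 < d 0 i) ->
  T *m u = l *: (diag_mx d *m u) -> u != 0 -> 0 <= l.
Proof.
move=> Tle0 T0 d_gt0 Tu /cV0Pn[i1 ui1].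
have [i _ umax] := arg_maxP (fun i => `|u i 0|) (erefl : xpredT i1).
have ui_gt0 : 0 < `|u i 0|.
  by apply: lt_le_trans (umax i1 isT); rewrite normr_gt0.
pose s := Num.sg (u i 0).
have su_le j : s * u j 0 <= `|u i 0|.
  apply: le_trans (ler_norm _) _.
  by rewrite normrM normr_sg -normr_gt0 ui_gt0 mul1r; apply: umax.
have sui : s * u i 0 = `|u i 0| by rewrite -normrEsg.
(* Row [i] of the equation times [s]. The zero row sum allows subtracting the maximum from every
   coordinate, which makes each off-diagonal term a product of two nonpositive factors. *)
have : l * (d 0 i * `|u i 0|) = \sum_j T i j * (s * u j 0 - `|u i 0|).
  under eq_bigr do rewrite mulrBr; rewrite sumrB -mulr_suml T0 mul0r subr0.
  under eq_bigr do rewrite mulrCA; rewrite -mulr_sumr.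
  have /matrixP/(_ i 0) := Tu; rewrite mul_diag_mx !mxE => ->.
  by rewrite -sui !mulrA; congr (_ * _); rewrite mulrC mulrA.
move=> ld; rewrite -(pmulr_lge0 _ (mulr_gt0 (d_gt0 i) ui_gt0)) ld.
apply: sumr_ge0 => j _; have [<-|ij] := eqVneq i j.
  by rewrite sui subrr mulr0.
by rewrite mulr_le0 ?Tle0 // subr_le0.
Qed.

(** With [E] the diagonal matrix of the [1 / sqrt d], the matrix [E *m E *m T] is similar to the
    symmetric [E *m T *m E], whose eigenvectors are carried back by [E]. *)
Lemma path_laplacian_eigenbasis (R : realType) (m : nat) (T : 'M[R]_m)
    (d : 'rV[R]_m) :
  (0 < m)%N -> T^T = T -> (forall i j : 'I_m, (j.+1 < i)%N -> T i j = 0) ->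
  (forall i j : 'I_m, i = j.+1 :> nat -> T i j < 0) ->
  (forall i, \sum_j T i j = 0) -> (forall i, 0 < d 0 i) ->
  exists (lam : 'I_m -> R) (Q : 'M[R]_m),
    ordered_eigenbasis (invmx (diag_mx d) *m T) lam Q.
Proof.
move=> m_gt0 Tsym T0 Tlt0 Tsum d_gt0.
set A := _ *m T.
have Toff i j : i != j -> T i j <= 0.
  wlog ji : i j / (j < i)%N => [hw ij|ij].
    have [ji|ji] := ltnP j i; first exact: hw.
    by rewrite -Tsym mxE hw 1?eq_sym // ltn_neqAle ji andbT.
  have [/T0 -> //|] := ltnP j.+1 i.
  by rewrite leq_eqVlt ltnS leqNgt ji orbF => /eqP/Tlt0/ltW.
pose c j := (Num.sqrt (d 0 j))^-1.
have c_gt0 j : 0 < c j by rewrite invr_gt0 sqrtr_gt0.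
have c2 j : c j * c j = (d 0 j)^-1.
  by rewrite -invfM -expr2 sqr_sqrtr // ltW.
pose E := diag_mx (\row_j c j).
have EE : invmx (diag_mx d) = E *m E.
  have DEE : E *m E *m diag_mx d = 1%:M.
    rewrite !mulmx_diag; apply/matrixP => i j; rewrite !mxE c2.
    by rewrite mulVf // gt_eqF.
  have [_ Du] := mulmx1_unit DEE.
  by rewrite -[LHS]mul1mx -DEE mulmxK.
pose S := E *m T *m E.
have SE i j : S i j = c i * T i j * c j.
  by rewrite /S mul_mx_diag mul_diag_mx !mxE.
have [||| V [l [Vu l_inj VS]]] := @jacobi_eigenbasis _ _ S.
- by rewrite /S !trmx_mul !tr_diag_mx Tsym mulmxA.
- by move=> i j ij; rewrite SE T0 // mulr0 mul0r.
- by move=> i j ij; rewrite SE !mulf_neq0 ?[T i j == 0]lt_eqF ?Tlt0 // gt_eqF.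
pose Q := E *m V^T.
have Qu : Q \in unitmx.
  rewrite unitmx_mul unitmx_tr Vu andbT unitmxE det_diag unitfE.
  by apply/prodf_neq0 => j _; rewrite mxE gt_eqF.
have AQ : A *m Q = Q *m diag_mx l.
  have ST : V *m S = V *m S^T.
    by rewrite /S !trmx_mul !tr_diag_mx Tsym !mulmxA.
  rewrite /A EE /Q -[RHS]mulmxA -[in RHS]tr_diag_mx -[in RHS]trmx_mul -VS ST.
  by rewrite trmx_mul trmxK /S !mulmxA.
have AQk k : A *m col k Q = l 0 k *: col k Q.
  have -> : A *m col k Q = col k (A *m Q) by rewrite !colE mulmxA.
  by rewrite AQ; apply/colP => i; rewrite mxE mul_mx_diag !mxE mulrC.
have Qk_neq0 k : col k Q != 0.
  by rewrite -trmx_eq0 tr_col row_unit_neq0 // unitmx_tr.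
have Du : diag_mx d \in unitmx.
  by rewrite unitmxE det_diag unitfE; apply/prodf_neq0 => j _; rewrite gt_eqF.
have l_ge0 k : 0 <= l 0 k.
  apply: (laplacian_eigenvalue_ge0 Toff Tsum d_gt0 _ (Qk_neq0 k)).
  by rewrite scalemxAr -AQk mulmxA /A mulKVmx.
(* If every eigenvalue were nonzero, [A] would be invertible; yet it kills the constant vectors, as
   the row sums of [T] vanish. *)
have [k0 lk0] : exists k0, l 0 k0 = 0.
  suff /existsP[k0 /eqP] : [exists k0, l 0 k0 == 0] by exists k0.
  apply: contraT; rewrite negb_exists => /forallP lneq0.
  have : Q *m diag_mx l \in unitmx.
    rewrite unitmx_mul Qu unitmxE det_diag unitfE.
    exact/prodf_neq0.
  rewrite -AQ unitmx_mul => /andP[Au _].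
  have A1 : A *m const_mx 1 = 0 :> 'cV_m.
    rewrite -mulmxA (_ : T *m _ = 0) ?mulmx0 //.
    apply/colP => i; rewrite !mxE -[RHS](Tsum i); apply: eq_bigr => j _.
    by rewrite mxE mulr1.
  have := mulKmx Au (const_mx 1 : 'cV[R]_m); rewrite A1 mulmx0.
  by move/colP/(_ (Ordinal m_gt0)); rewrite !mxE => /esym/eqP; rewrite oner_eq0.
(* The transposition moves the zero eigenvalue to index 0; by injectivity all the others are
   nonzero, hence positive. *)
pose s := tperm (Ordinal m_gt0) k0.
exists (fun k => l 0 (s k)), (col_perm s Q); split.
- by rewrite col_permE unitmx_mul Qu unitmx_perm.
- move=> k; rewrite (_ : col k _ = col (s k) Q) //.
  by apply/colP => i; rewrite !mxE.
- by move=> i j /l_inj/perm_inj.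
- move=> k; have [k_eq0|k_neq0] := eqVneq.
    by rewrite (_ : k = Ordinal m_gt0) ?tpermL //; apply: val_inj.
  rewrite lt_neqAle l_ge0 andbT eq_sym -lk0 (inj_eq l_inj).
  apply: contra_neq k_neq0 => sk.
  by rewrite -(tpermK (Ordinal m_gt0) k0 k) -/s sk tpermR.
Qed.

(** * The tridiagonal system matrix *)

(* The system matrix is the Laplacian of the path whose edge between nodes k and
   k + 1 (counted from 0) has this weight. *)
Definition conductance (R : realType) (n : nat) (L H : R) (k : nat) : R :=
  if k == n.-1 then 1 / (2 * L) else 1 / (H / (n%:R - 1)).

(** In this form the signs of the entries and the zero row sums can be read off. A diagonal entry is
    the total weight of the edges at the node; the nodes [n.-1] and [n] are the two ends of the edge
    of weight [1 / (2 * L)]. *)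
Lemma tridiag_mxE (R : realType) (n : nat) (L H : R) (i j : 'I_(2 * n)) :
  (2 < n)%N ->
  tridiag_mx n L H i j =
    (j == i)%:R * ((if (0 < i)%N then conductance n L H i.-1 else 0) +
                   (if (i.+1 < 2 * n)%N then conductance n L H i else 0)) -
    (j == i.+1 :> nat)%:R * conductance n L H i -
    (i == j.+1 :> nat)%:R * conductance n L H j.
Proof.
move=> n2; rewrite mxE /conductance; set h := H / _; have im := ltn_ord i.
rewrite [j == i]eq_sym; have [<-|ij] := eqVneq i j.
  rewrite (ltn_eqF (ltnSn i)) /= !mul0r !subr0 !mul1r.
  case: (eqVneq (i : nat) 0%N) => i0.
    have [e1 e2] : (1 < 2 * n)%N /\ (0 == n.-1)%N = false by lia.
    by rewrite i0 /= add0r e1 e2.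
  rewrite lt0n i0 /=; case: (eqVneq (i : nat) (2 * n).-1) => i1.
    have [e1 e2] : (i.+1 < 2 * n)%N = false /\ (i.-1 == n.-1)%N = false by lia.
    by rewrite e1 e2 addr0.
  have -> : (i.+1 < 2 * n)%N by lia.
  have -> : (i.-1 == n.-1)%N = (i == n :> nat) by lia.
  case: (eqVneq (i : nat) n.-1) => i2 /=.
    by have -> : (i == n :> nat) = false by lia.
  by case: (eqVneq (i : nat) n) => i3; rewrite ?mulrDl ?mul1r 1?addrC.
rewrite mul0r add0r.
case: (eqVneq (j : nat) i.+1) => ji /=.
  have [-> ->] : (i == j.+1 :> nat) = false /\ minn i j = i by lia.
  by rewrite mul0r subr0 !mul1r; case: ifP.
case: (eqVneq (i : nat) j.+1) => ji' /=; last by rewrite !mul0r !oppr0 addr0.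
have -> : minn i j = j by lia.
by rewrite mul0r oppr0 sub0r !mul1r; case: ifP.
Qed.

Lemma conductance_gt0 (R : realType) (n : nat) (L H : R) k :
  (2 < n)%N -> 0 < L -> 0 < H -> 0 < conductance n L H k.
Proof.
move=> n2 L0 H0; rewrite /conductance; case: ifP => _.
  by rewrite divr_gt0 // mulr_gt0.
by rewrite !divr_gt0 // subr_gt0 ltr1n ltnW.
Qed.

(** Each edge at node [i] contributes its weight once on the diagonal and once, negated, off it; an
    edge missing at an end of the path is missing from both. *)
Lemma tridiag_mx_row_sum (R : realType) (n : nat) (L H : R) (i : 'I_(2 * n)) :
  (2 < n)%N -> \sum_j tridiag_mx n L H i j = 0.
Proof.
move=> n2; set w := conductance n L H.
under eq_bigr do rewrite tridiag_mxE // -/w.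
have ord_delta (P : pred 'I_(2 * n)) (F : 'I_(2 * n) -> R) k :
    P =1 pred1 k -> \sum_j (P j)%:R * F j = F k.
  move=> Pk; rewrite (bigD1 k) //= Pk /= eqxx mul1r big1 ?addr0 // => j jk.
  by rewrite Pk /= (negPf jk) mul0r.
have ord_delta0 (P : pred 'I_(2 * n)) (F : 'I_(2 * n) -> R) :
    P =1 pred0 -> \sum_j (P j)%:R * F j = 0.
  by move=> P0; rewrite big1 // => j _; rewrite P0 mul0r.
rewrite !sumrB (ord_delta _ _ i) //.
have -> : \sum_(j < 2 * n) (j == i.+1 :> nat)%:R * w i =
    (if (i.+1 < 2 * n)%N then w i else 0).
  case: ifP => im; first by apply: (ord_delta _ _ (Ordinal im)).
  by apply: ord_delta0 => j /=; have := ltn_ord j; lia.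
have -> : \sum_(j < 2 * n) (i == j.+1 :> nat)%:R * w j =
    (if (0 < i)%N then w i.-1 else 0).
  case: ifP => im; last by apply: ord_delta0 => j /=; lia.
  have im' : (i.-1 < 2 * n)%N by have := ltn_ord i; lia.
  apply: (ord_delta _ _ (Ordinal im')) => j /=.
  by rewrite -(inj_eq val_inj) /=; lia.
by rewrite addrK subrr.
Qed.

Lemma tridiag_mx_sym (R : realType) (n : nat) (L H : R) :
  (tridiag_mx n L H)^T = tridiag_mx n L H.
Proof.
apply/matrixP => i j; rewrite !mxE [j == i]eq_sym; case: eqVneq => [->//|_].
by rewrite orbC minnC.
Qed.

(** * Positivity of the capacitance *)

Section Capacitance.
Variables (R : realType) (zm zp : R).
Hypotheses (hzm : zm < 0) (hzp : 0 < zp).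

Let f (u : R) : R :=
  - zm * expR (- (zp * u)) + zp * expR (- (zm * u)) + zm - zp.
Let g (u : R) : R := zp * zm * (expR (- (zp * u)) - expR (- (zm * u))).
Let dg (u : R) : R :=
  zp * zm * (- zp * expR (- (zp * u)) + zm * expR (- (zm * u))).

Let is_derive_f (u : R) : is_derive u 1 f (g u).
Proof.
rewrite /f; apply: is_derive_eq.
rewrite /g /GRing.scale /=; ring.
Qed.

Let is_derive_g (u : R) : is_derive u 1 g (dg u).
Proof.
rewrite /g; apply: is_derive_eq.
rewrite /dg /GRing.scale /=; ring.
Qed.

(** The exponential lies strictly above its tangent at 0. When the two tangents are weighted by the
    positive numbers [- zm] and [zp], the terms linear in [u] cancel, and so do the constants with
    [zm - zp]. *)
Let f_gt0 u : u != 0 -> 0 < f u.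
Proof.
move=> u0; have hz x : x != 0 -> 1 + x < expR x by exact: expR_gt1Dx.
have h1 : 1 + - (zp * u) < expR (- (zp * u)).
  by apply: hz; rewrite oppr_eq0 mulf_neq0 // gt_eqF.
have h2 : 1 + - (zm * u) < expR (- (zm * u)).
  by apply: hz; rewrite oppr_eq0 mulf_neq0 // lt_eqF.
have zm' : 0 < - zm by rewrite oppr_gt0.
have h1' : 0 < - zm * (expR (- (zp * u)) - (1 + - (zp * u))).
  by rewrite mulr_gt0 // subr_gt0.
have h2' : 0 < zp * (expR (- (zm * u)) - (1 + - (zm * u))).
  by rewrite mulr_gt0 // subr_gt0.
rewrite /f; lra.
Qed.

Let sg_g u : Num.sg (g u) = Num.sg u.
Proof.
have zz : zp * zm < 0 by rewrite pmulr_rlt0.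
rewrite /g sgrM (ltr0_sg zz) mulN1r -sgrN opprB.
have [u0|u0|->] := ltgtP u 0; last by rewrite !mulr0 subrr.
- by rewrite !ltr0_sg // subr_lt0 ltr_expR ltrN2 ltr_nM2r // (lt_trans hzm).
- by rewrite !gtr0_sg // subr_gt0 ltr_expR ltrN2 ltr_pM2r // (lt_trans hzm).
Qed.

(** The factor [Num.sg u] turns [g u] into its absolute value. At [u = 0] both sides are 0, by
    [Num.sg 0 = 0] and [g 0 = 0]. *)
Let formulaE u : capacitance_formula zm zp u = Num.sqrt (g u ^+ 2 / (2 * f u)).
Proof.
rewrite sqrtrM ?sqr_ge0 // sqrtr_sqr sqrtrV; last first.
  have [->|/f_gt0 fu] := eqVneq u 0; last by rewrite mulr_ge0 ?ler0n ?ltW.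
  by rewrite /f !mulr0 oppr0 expR0; lra.
by rewrite sqrtrM // normrEsg sg_g /capacitance_formula mulrA.
Qed.

Lemma alpha_gt0 : 0 < alpha zm zp.
Proof.
have : 0 < zp ^+ 2 * - zm by rewrite mulr_gt0 ?oppr_gt0 // exprn_gt0.
have : 0 < zm ^+ 2 * zp by rewrite mulr_gt0 // exprn_even_gt0 //= lt_eqF.
rewrite /alpha; lra.
Qed.

Lemma capacitance_formula_cvg0 :
  capacitance_formula zm zp u @[u --> (0 : R)^'] --> Num.sqrt (alpha zm zp).
Proof.
rewrite (_ : capacitance_formula zm zp =
    fun u => Num.sqrt (g u ^+ 2 / (2 * f u))); last exact/funext/formulaE.
apply: (@continuous_cvg _ _ _ _ _ _ Num.sqrt); first exact: sqrt_continuous.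
have g_cont : {for 0, continuous g}.
  by apply/differentiable_continuous/derivable1_diffP; case: (is_derive_g 0).
have f_cont : {for 0, continuous f}.
  by apply/differentiable_continuous/derivable1_diffP; case: (is_derive_f 0).
have dg_cont : {for 0, continuous dg}.
  apply/differentiable_continuous/derivable1_diffP; rewrite /dg.
  exact: ex_derive.
have g0 : g 0 = 0 by rewrite /g !mulr0 subrr mulr0.
have f0 : f 0 = 0 by rewrite /f !mulr0 oppr0 expR0; lra.
have alphaE : alpha zm zp = dg 0.
  by rewrite /alpha /dg !mulr0 oppr0 expR0; ring.
(* [lhopital] needs the quotient of the derivatives [2 * g * dg] and [2 * g] to
   converge on a full neighbourhood of 0, where it has the junk value 0 / 0;
   changing both derivatives at 0 removes it. *)
pose k u : R := if u == 0 then 1 else 2 * g u.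
have k_neq0 u : k u != 0.
  rewrite /k; case: (eqVneq u 0) => [_|u0]; first by rewrite oner_eq0.
  by rewrite mulf_neq0 // -sgr_eq0 sg_g sgr_eq0.
apply: (@lhopital R _ (fun u => dg u * k u) _ k (-1) 1 0).
- by rewrite in_itv /= ltrN10 ltr01.
- move=> x; rewrite inE => -[_ /eqP x0]; apply: is_derive_eq.
  rewrite /k (negPf x0) /dg /g /GRing.scale /=; ring.
- move=> x; rewrite inE => -[_ /eqP x0]; apply: is_derive_eq.
  rewrite /k (negPf x0) /dg /g /GRing.scale /=; ring.
- have : g x ^+ 2 @[x --> 0] --> g 0 ^+ 2 by apply: cvgM.
  by rewrite g0 expr0n.
- have : 2 * f x @[x --> 0] --> 2 * f 0.
    by apply: cvgM; [exact: cvg_cst|exact: f_cont].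
  by rewrite f0 mulr0.
- by move=> x _.
(* The quotient of the derivatives is [dg u * k u / k u = dg u], which tends to [dg 0]. *)
- rewrite alphaE; under eq_fun do rewrite mulfK //.
  exact: dg_cont.
Qed.

Lemma capacitance_gt0 u : 0 < capacitance zm zp u.
Proof.
rewrite /capacitance; case: eqVneq => [_|u0].
  rewrite (cvg_lim _ capacitance_formula_cvg0) ?sqrtr_gt0 ?alpha_gt0 //.
rewrite formulaE sqrtr_gt0 divr_gt0 //; last by rewrite mulr_gt0 ?f_gt0.
by rewrite exprn_even_gt0 //= -sgr_eq0 sg_g sgr_eq0.
Qed.

End Capacitance.

(** * Decay rates of the projected linear equation *)

(** Integrating factor: [y s * expR (- c * s)] has zero derivative on []0, t[], so by the mean value
    theorem it agrees at 0 and [t]. Continuity up to 0 brings in the initial value. *)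
Lemma linear_ode_sol (R : realType) (c : R) (y : R -> R) :
  {within `[0, +oo[, continuous y} ->
  (forall t : R, 0 < t -> is_derive t 1 y (c * y t)) ->
  forall t, 0 <= t -> y t = y 0 * expR (c * t).
Proof.
move=> yc yd t t0; pose z s := y s * expR (- c * s).
have ec : continuous (fun s : R => expR (- c * s)).
  move=> s; apply: (@continuous_comp _ _ _ ( *%R (- c)) expR).
    exact: mulrl_continuous.
  exact: continuous_expR.
have zd s : s \in `]0, t[ -> is_derive s 1 z 0.
  rewrite in_itv /= => /andP[/yd ys _]; rewrite /z; apply: is_derive_eq.
  rewrite /GRing.scale /=; ring.
have zc : {within `[0, t], continuous z}.
  move=> s; apply: (@continuousM _ (subspace `[0, t]) y) => /=.
    by apply: (continuous_subspaceW _ yc); apply: subset_itvl.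
  exact: (continuous_subspaceT ec).
have [s _] := MVT_segment t0 zd zc.
rewrite mul0r /z mulr0 expR0 mulr1 => /eqP; rewrite subr_eq0 => /eqP <-.
by rewrite -mulrA -expRD mulNr addNr expR0 mulr1.
Qed.

Lemma is_derive_mulmx (R : realType) (m n p : nat) (P : 'M[R]_(p, m))
    (q : R -> 'M[R]_(m, n)) (t : R) i j :
  derivable q t 1 ->
  is_derive t 1 (fun s => (P *m q s) i j) ((P *m 'D_1 q t) i j).
Proof.
move=> qd; rewrite mxE.
have -> : (fun s => (P *m q s) i j) = \sum_k (fun s => P i k *: q s k j).
  by apply/funext => s; rewrite mxE fct_sumE.
apply: is_derive_sum => k; apply: is_deriveZ.
by rewrite derive_mx // mxE; apply/derivableP; move/derivable_mxP : qd.
Qed.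

Lemma mulmx_coord_continuous (R : realType) (m n p : nat) (P : 'M[R]_(p, m))
    i j :
  continuous (fun x : 'M[R]_(m, n) => (P *m x) i j).
Proof.
under eq_fun do rewrite mxE.
apply: continuous_big => [|k _]; first exact: add_continuous.
move=> x; apply: (@continuousM _ _ (fun=> P i k)); first exact: cst_continuous.
exact: coord_continuous.
Qed.

Lemma mx_norm_ge (R : realType) (m n : nat) (x : 'M[R]_(m, n)) i j :
  `|x i j| <= `|x|.
Proof.
rewrite [leRHS]mx_normrE.
exact: (le_bigmax _ (fun ij => `|x ij.1 ij.2|) (i, j)).
Qed.

Lemma mx_norm_le (R : realType) (m n : nat) (x : 'M[R]_(m, n)) (K : R) :
  0 <= K -> (forall i j, `|x i j| <= K) -> `|x| <= K.
Proof. by move=> K0 xK; rewrite [leLHS]mx_normrE; apply: bigmax_le. Qed.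

(** If [l < r], the unbounded function [expR ((r - l) * t)] would stay below [K] for all
    [t >= 0]. *)
Lemma expR_rate_le (R : realType) (K r l : R) :
  (forall t, 0 <= t -> expR (- (l * t)) <= K * expR (- (r * t))) -> r <= l.
Proof.
move=> hK; rewrite leNgt; apply/negP => lr.
have rl : 0 < r - l by rewrite subr_gt0.
(* At this time the exponent [(r - l) * t] is the absolute value of [K], and its exponential exceeds
   [K] because [expR x >= 1 + x]. *)
pose t := `|K| / (r - l); have t0 : 0 <= t by rewrite divr_ge0 // ltW.
have := hK t t0; rewrite -ler_pdivrMr ?expR_gt0 // -expRN opprK -expRD.
have -> : - (l * t) + r * t = `|K| by rewrite /t; field; rewrite gt_eqF.
move=> /(le_trans (expR_ge1Dx _)); have := ler_norm K; lra.
Qed.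

(** * Eigenbases and the projection off the zero mode *)

Lemma mul_shift_mx (R : realType) (m n : nat) (B : 'M[R]_(m.+1, n)) :
  shift_mx R m.+1 *m B = row' ord0 B.
Proof.
apply/matrixP => i j; rewrite !mxE (bigD1 (lift ord0 i)) //= mxE eqxx mul1r.
rewrite big1 ?addr0 // => k ki.
by rewrite mxE (_ : (k == i.+1 :> nat) = false) ?mul0r //; apply/negbTE.
Qed.

Lemma ordered_eigenbasis_mulmx (R : realType) (m : nat) (A Q : 'M[R]_m)
    (lam : 'I_m -> R) :
  ordered_eigenbasis A lam Q ->
  invmx Q *m A = diag_mx (\row_k lam k) *m invmx Q.
Proof.
move=> [Qu AQk _ _].
have AQ : A *m Q = Q *m diag_mx (\row_k lam k).
  apply/matrixP => i k; have /colP/(_ i) := AQk k.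
  rewrite mul_mx_diag !mxE [in RHS]mulrC => <-.
  by apply: eq_bigr => j _; rewrite mxE.
by rewrite -[LHS](mulmxK Qu) -(mulmxA _ A) AQ mulKmx.
Qed.

(** Given a row eigenvector [v], some column [q] of [Q] has [v *m q] nonzero, and evaluating
    [v *m (a *: A) *m q] from both sides equates the eigenvalues. Conversely, the rows of [invmx Q]
    are row eigenvectors. *)
Lemma ordered_eigenbasis_eigenvalue (R : realType) (m : nat) (A Q : 'M[R]_m)
    (lam : 'I_m -> R) (a l : R) :
  ordered_eigenbasis A lam Q ->
  eigenvalue (a *: A) l <-> exists k, l = a * lam k.
Proof.
move=> eigQ; have QA := ordered_eigenbasis_mulmx eigQ.
have [Qu AQk _ _] := eigQ; split=> [/eigenvalueP[v vA v0]|[k ->]].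
  have vQ0 : v *m Q != 0.
    by apply: contra_neq v0 => vQ; rewrite -[v](mulmxK Qu) vQ mul0mx.
  have [k vQk] := rV0Pn _ vQ0; exists k; apply: (mulIf vQk).
  have vQkE : (v *m Q) 0 k = (v *m col k Q) 0 0.
    by rewrite !mxE; apply: eq_bigr => j _; rewrite mxE.
  have : v *m (a *: A) *m col k Q = l *: (v *m col k Q) by rewrite vA scalemxAl.
  rewrite -mulmxA -scalemxAl AQk -!scalemxAr scalerA => /matrixP/(_ 0 0).
  by rewrite mxE [RHS]mxE -vQkE.
apply/eigenvalueP; exists (row k (invmx Q)).
  rewrite -scalemxAr -row_mul QA; apply/rowP => j.
  by rewrite mul_diag_mx !mxE mulrA.
by rewrite row_unit_neq0 // unitmx_inv.
Qed.

Lemma smallest_positive_eigenvalue_ex (R : realType) (m : nat) (A Q : 'M[R]_m)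
    (lam : 'I_m -> R) (a : R) :
  (1 < m)%N -> 0 < a -> ordered_eigenbasis A lam Q ->
  exists l, smallest_positive_eigenvalue (a *: A) l.
Proof.
move=> m1 a0 eigQ; have [_ _ _ lam_gt0] := eigQ.
have [k k0 kmin] :=
  @arg_minP _ _ _ (Ordinal m1) (fun k => k != 0%N :> nat) lam isT.
exists (a * lam k); split.
- by apply/(ordered_eigenbasis_eigenvalue _ _ eigQ); exists k.
- by rewrite mulr_gt0 //; have := lam_gt0 k; rewrite (negPf k0).
- move=> l /(ordered_eigenbasis_eigenvalue _ _ eigQ)[j ->].
  rewrite pmulr_rgt0 // ler_pM2l // => lamj; apply: kmin.
  apply: contraTneq lamj => j0; have := lam_gt0 j.
  by rewrite j0 /= => ->; rewrite ltxx.
Qed.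

Lemma projection_mxE (R : realType) (m : nat) (Q : 'M[R]_m.+1) (i : 'I_m) j :
  projection_mx Q i j = invmx Q (lift ord0 i) j.
Proof. by rewrite /projection_mx mul_shift_mx mxE. Qed.

(** The rows of [invmx Q] are left eigenvectors of [A]; this makes the projected equation closed in
    the projected unknown, and diagonal. *)
Lemma projection_mulmx (R : realType) (m : nat) (A Q : 'M[R]_m.+1)
    (lam : 'I_m.+1 -> R) :
  ordered_eigenbasis A lam Q ->
  projection_mx Q *m A =
    diag_mx (\row_i lam (lift ord0 i)) *m projection_mx Q.
Proof.
move=> eigQ; apply/matrixP => i j; rewrite mul_diag_mx [RHS]mxE projection_mxE.
rewrite /projection_mx -mulmxA (ordered_eigenbasis_mulmx eigQ).
by rewrite mul_shift_mx mul_diag_mx !mxE.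
Qed.

Lemma projection_col (R : realType) (m : nat) (Q : 'M[R]_m.+1) (i k : 'I_m) :
  Q \in unitmx -> (projection_mx Q *m col (lift ord0 k) Q) i 0 = (i == k)%:R.
Proof.
move=> Qu; rewrite mxE.
under eq_bigr do rewrite projection_mxE [col _ _ _ _]mxE.
transitivity ((invmx Q *m Q) (lift ord0 i) (lift ord0 k)); first by rewrite mxE.
by rewrite mulVmx // mxE (inj_eq lift_inj).
Qed.

(** The pure mode of eigenvalue [lc] bounds every rate by [lc]. Conversely, each coordinate of the
    projected solution is an exponential of rate at least [lc]. *)
Lemma decay_rateP (R : realType) (m : nat) (A Q : 'M[R]_m) (lam : 'I_m -> R)
    (a lc : R) :
  0 < a -> ordered_eigenbasis A lam Q ->
  smallest_positive_eigenvalue (a *: A) lc ->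
  forall r, decay_rate a A (projection_mx Q) r <-> r <= lc.
Proof.
case: m => [|m] in A Q lam * => a0 eigQ [].
  by move=> /(ordered_eigenbasis_eigenvalue _ _ eigQ)[[]].
move=> /(ordered_eigenbasis_eigenvalue _ _ eigQ)[k lck] lc0 lc_min r.
have [Qu AQk _ lam_gt0] := eigQ.
have lc_le (i : 'I_m) : lc <= a * lam (lift ord0 i).
  apply: lc_min.
    by apply/(ordered_eigenbasis_eigenvalue _ _ eigQ); exists (lift ord0 i).
  by rewrite mulr_gt0 //; have := lam_gt0 (lift ord0 i).
set P := projection_mx Q; split=> [rP|rlc q [qc qd]].
  (* Index 0 carries the eigenvalue 0, so the positive [lc] belongs to a mode that the projection
     keeps. *)
  have [i ki] : exists i : 'I_m, k = lift ord0 i.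
    case: (unliftP ord0 k) => [i ->|k0]; first by exists i.
    have lamk0 : lam k = 0 by have := lam_gt0 k; rewrite k0.
    by move: lc0; rewrite lck lamk0 mulr0 ltxx.
  (* Coordinate [i] of the projection of this solution is exactly [expR (- (lc * t))]. *)
  pose q t := expR (- (lc * t)) *: col k Q.
  have q_der (t : R) : derivable q t 1.
    apply/derivable_mxP => j j'; rewrite /q; under eq_fun do rewrite mxE.
    exact: ex_derive.
  have qD (t : R) : 'D_1 q t = - (lc *: q t).
    rewrite derive_mx //; apply/matrixP => j j'; rewrite mxE.
    rewrite (_ : (fun s => q s j j') =
        fun s => expR (- (lc * s)) * col k Q j j').
      rewrite derive_val /q !mxE /GRing.scale /=; ring.
    by apply/funext => s; rewrite mxE.
  have [|K hK] := rP q.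
    split=> [|t _]; first exact: derivable_within_continuous.
    split=> //; rewrite qD mulmxN -scalemxAr lck -scalerA; congr (- (a *: _)).
    rewrite /q -[P *m A *m _]mulmxA -!scalemxAr AQk -scalemxAr !scalerA.
    by rewrite mulrC.
  apply: (@expR_rate_le _ K) => t t0; apply: le_trans (hK t t0).
  apply: le_trans (mx_norm_ge _ i 0).
  rewrite /q -scalemxAr mxE ki projection_col // eqxx mulr1.
  by rewrite ger0_norm ?expR_ge0.
have PqE i t : 0 <= t ->
    (P *m q t) i 0 = (P *m q 0) i 0 * expR (- (a * lam (lift ord0 i)) * t).
  apply: (linear_ode_sol (y := fun t => (P *m q t) i 0)).
    apply: (@within_continuous_comp _ _ _ _ q (fun x => (P *m x) i 0)) => //.
    move=> x _; exact: mulmx_coord_continuous.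
  move=> s s0; have [qds qDs] := qd s s0.
  apply: (is_derive_eq (is_derive_mulmx _ _ _ qds)).
  rewrite qDs (projection_mulmx eigQ) -/P mxE [X in - X]mxE -mulmxA mul_diag_mx.
  by rewrite [X in - (_ * X)]mxE [X in - (_ * (X * _))]mxE mulNr mulrA.
exists `|P *m q 0| => t t0; apply: mx_norm_le => [|i j].
  by rewrite mulr_ge0 ?expR_ge0.
rewrite ord1 PqE // normrM [X in _ * X]ger0_norm ?expR_ge0 //.
rewrite ler_pM ?expR_ge0 // ?mx_norm_ge // ler_expR -[- (r * t)]mulNr.
by rewrite ler_wpM2r // lerN2 (le_trans rlc).
Qed.

(** * Charging timescale at the equilibrium *)

Lemma capacitance_mx_diag (R : realType) (n : nat) (zm zp : R)
    (zeta : 'cV[R]_(2 * n)) : zm < 0 -> 0 < zp ->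
  exists2 d : 'rV[R]_(2 * n), capacitance_mx zm zp zeta = diag_mx d &
    forall i, 0 < d 0 i.
Proof.
move=> hzm hzp; eexists; first by [].
move=> i; rewrite mxE; have := capacitance_gt0 hzm hzp (zeta i 0).
by case: ifP => // _; apply: mulr_gt0.
Qed.

Theorem theorem4p1 (R : realType) (n : nat) (zm zp Vp Vm L H : R)
  (zeta : R -> 'cV[R]_(2 * n)) (zinf : 'cV[R]_(2 * n))
  (hn : (2 < n)%N) (hzm : zm < 0) (hzp : 0 < zp)
  (hL : 0 < L) (hH : 0 < H) (hLH : L + H = 1)
  (hzeta : charging_solution zm zp Vp Vm L H zeta) (hzeta0 : zeta 0 = 0)
  (hzinf : zeta t @[t --> +oo] --> zinf) :
  (exists (lam : 'I_(2 * n) -> R) (Q : 'M[R]_(2 * n)),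
     ordered_eigenbasis (relaxation_mx zm zp L H zinf) lam Q) /\
  exists lc : R,
    smallest_positive_eigenvalue
      (alpha zm zp *: relaxation_mx zm zp L H zinf) lc /\
    forall (lam : 'I_(2 * n) -> R) (Q : 'M[R]_(2 * n)),
      ordered_eigenbasis (relaxation_mx zm zp L H zinf) lam Q ->
      forall tau : R,
        charging_timescale zm zp L H zinf Q tau <-> tau = 1 / lc.
Proof.
have [d Cd d_gt0] := capacitance_mx_diag zinf hzm hzp.
have a_gt0 := alpha_gt0 hzm hzp.
have [lam [Q eigQ]] : exists (lam : 'I_(2 * n) -> R) (Q : 'M[R]_(2 * n)),
    ordered_eigenbasis (relaxation_mx zm zp L H zinf) lam Q.
  rewrite /relaxation_mx Cd; apply: path_laplacian_eigenbasis => //.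
  - by lia.
  - exact: tridiag_mx_sym.
  - move=> i j ij; rewrite tridiag_mxE //.
    have [-> -> ->] : [/\ (j == i) = false, (j == i.+1 :> nat) = false
        & (i == j.+1 :> nat) = false].
      by rewrite -(inj_eq val_inj) /=; split; lia.
    by rewrite !mul0r !subr0.
  - move=> i j ij; rewrite tridiag_mxE //.
    have [-> -> ->] : [/\ (j == i) = false, (j == i.+1 :> nat) = false
        & (i == j.+1 :> nat) = true].
      by rewrite -(inj_eq val_inj) /=; split; lia.
    by rewrite !mul0r mul1r subr0 sub0r oppr_lt0 conductance_gt0.
  - by move=> i; rewrite tridiag_mx_row_sum.
split; first by exists lam, Q.
have [|lc lcP] := smallest_positive_eigenvalue_ex _ a_gt0 eigQ; first by lia.
exists lc; split=> // lam' Q' eigQ' tau.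
have rateP := decay_rateP a_gt0 eigQ' lcP.
(* By [rateP], [1 / tau] is the largest number that is at most [lc], that is, [lc] itself; inversion
   is involutive, at 0 too, so this amounts to [tau = 1 / lc]. *)
rewrite /charging_timescale; split=> [[/rateP tau_le tau_max]|->].
  have /eqP : lc == 1 / tau.
    by rewrite eq_le tau_le tau_max //; apply/rateP.
  by move=> ->; rewrite !div1r invrK.
by rewrite !div1r invrK; split=> [|r /rateP]; [apply/rateP|].
Qed.
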